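(* If $A$ is a $\sigma$-unital C*-algebra, then for every countable $\ll$-directed $B\subseteq A^1_+$ there is a countable $\ll$-unit $U$ for $A$ such that $B\subseteq U$.
   Context: $A^1_+$ denotes the set of positive elements of $A$ of norm at most $1$. For $a,b\in A$, $a\ll b$ means $a=ab$. A subset $B$ is $\ll$-directed if for all $a,b\in B$ there is $c\in B$ with $a\ll c$ and $b\ll c$. A set $U\subseteq A^1_+$ is a $\ll$-unit for $A$ if it is $\ll$-directed and $\ll$-approximately cofinal in $A$, i.e. for every $a\in A$ and $\varepsilon>0$ there is $u\in U$ with $\|a-au\|<\varepsilon$. $A$ is $\sigma$-unital if it has a countable approximate unit, where an approximate unit is a net $(u_\lambda)$ in $A^1_+$ with $\|a-au_\lambda\|\to0$ for all $a\in A$. *)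

(* Defs.v *)
From HB Require Import structures.
From mathcomp Require Import all_boot all_order all_algebra.
From mathcomp Require Import all_classical all_reals all_analysis.
From mathcomp Require Import complex.

Set Implicit Arguments.
Unset Strict Implicit.
Unset Printing Implicit Defensive.

Import Order.TTheory GRing.Theory Num.Theory.
Import numFieldNormedType.Exports.

Local Open Scope classical_set_scope.
Local Open Scope ring_scope.

(* Not necessarily unital, and possibly zero, so the product cannot come from
   the ring structures of the library (these all have a unit).
   The norm of a normed module over R[i] takes its values in R[i]; its values
   are nonnegative, and in R[i] the conditions 0 <= x and 0 < x imply that x
   is real, so norm inequalities have their usual meaning. *)
HB.mixin Record isCStarAlgebra (R : realType) A
    of CompleteNormedModule R[i] A := {
  cmul : A -> A -> A ;
  cstar : A -> A ;
  cmulA : associative cmul ;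
  cmulDl : left_distributive cmul +%R ;
  cmulDr : right_distributive cmul +%R ;
  cmulZl : forall (k : R[i]) (a b : A), cmul (k *: a) b = k *: cmul a b ;
  cmulZr : forall (k : R[i]) (a b : A), cmul a (k *: b) = k *: cmul a b ;
  cstarK : involutive cstar ;
  cstarD : {morph cstar : a b / a + b} ;
  cstarZ : forall (k : R[i]) (a : A), cstar (k *: a) = (k^*)%R *: cstar a ;
  cstarM : forall a b : A, cstar (cmul a b) = cmul (cstar b) (cstar a) ;
  cnormM : forall a b : A, `|cmul a b| <= `|a| * `|b| ;
  cnorm_star : forall a : A, `|cmul (cstar a) a| = `|a| ^+ 2
}.

#[short(type="cstarAlgType")]
HB.structure Definition CStarAlgebra (R : realType) :=
  {A of isCStarAlgebra R A & CompleteNormedModule R[i] A}.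

Section CStarDefs.
Context {R : realType} {A : cstarAlgType R}.

Definition cpositive (a : A) : Prop := exists x : A, a = cmul (cstar x) x.

Definition pos_unit_ball : set A := [set a | cpositive a /\ `|a| <= 1].

Definition ll (a b : A) : Prop := a = cmul a b.

Definition ll_directed (B : set A) : Prop :=
  forall a b, B a -> B b -> exists2 c, B c & ll a c /\ ll b c.

Definition ll_approx_cofinal (U : set A) : Prop :=
  forall (a : A) (eps : R[i]), 0 < eps ->
    exists2 u, U u & `|a - cmul a u| < eps.

Definition ll_unit (U : set A) : Prop :=
  [/\ U `<=` pos_unit_ball, ll_directed U & ll_approx_cofinal U].

(* Index sets of nets: nonempty, preordered and upward directed. *)
Definition directed_preorder (L : Type) (le : L -> L -> Prop) : Prop :=
  [/\ exists l : L, True,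
      forall l, le l l,
      forall l m n, le l m -> le m n -> le l n
    & forall l m, exists2 n, le l n & le m n].

(* The net itself is not assumed to be increasing. *)
Definition approximate_unit (L : Type) (le : L -> L -> Prop) (u : L -> A) :
    Prop :=
  [/\ directed_preorder le,
      forall l, pos_unit_ball (u l)
    & forall (a : A) (eps : R[i]), 0 < eps ->
        exists l0, forall l, le l0 l -> `|a - cmul a (u l)| < eps].

End CStarDefs.

Definition sigma_unital (R : realType) (A : cstarAlgType R) : Prop :=
  exists (L : Type) (le : L -> L -> Prop) (u : L -> A),
    countable [set: L] /\ approximate_unit le u.

(* Main.v *)
(* If B is nonempty, it contains a cofinal sequence b_0 << b_1 << ...; let e_i
   run through a countable approximate unit. A suitable compression of
   h^2 + (1-h^2)^(1/2) e_i (1-h^2)^(1/2) with h = b_(n+1) satisfies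
   b_n z_n = b_n and absorbs any finite set up to an arbitrarily small error, so
   there are z_n such that z_(n+1) almost absorbs z_n and e_0, ..., e_n. There
   are continuous functions f (false ramp) and g (true ramp) with f(0) = g(0) = 0,
   f(1) = g(1) = 1 and f g = f. Replacing z_n by f(z_(n+1)) z_n f(z_(n+1)), with
   z_(n+1) replaced beforehand in the same way, and so on up to z_(n+d), gives in
   the limit d -> oo elements w_n close to z_n with w_n g(w_(n+1)) = w_n exactly,
   and B together with the g(w_n)^2 is the required unit.
   No spectral theory is needed: self-adjoint contractions take the role of
   positive elements until the final squaring, 1 - z with z in A is obtained as
   a square root by iteration, and polynomials are bounded through unitaries
   p + i(1 - r) of the unitization. *)

Require Import Defs.
From HB Require Import structures.
From mathcomp Require Import all_boot all_order all_algebra.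
From mathcomp Require Import all_classical all_reals all_analysis.
From mathcomp Require Import complex ring lra.

Set Implicit Arguments.
Unset Strict Implicit.
Unset Printing Implicit Defensive.

Import Order.TTheory GRing.Theory Num.Theory.
Import numFieldNormedType.Exports.

Local Open Scope classical_set_scope.
Local Open Scope ring_scope.

(* [int * V] with [V * V = 0]: a commutative ring containing the abelian group
   [V], in which [ring] decides linear identities of [V]. *)
Definition sqzero (V : zmodType) : Type := (int * V)%type.

Section SquareZero.
Variable V : zmodType.

HB.instance Definition _ := GRing.Zmodule.on (sqzero V).

Definition sqz_one : sqzero V := (1, 0).
Definition sqz_mul (x y : sqzero V) : sqzero V :=
  (x.1 * y.1, y.2 *~ x.1 + x.2 *~ y.1).

Lemma sqz_mulA : associative sqz_mul.
Proof.
move=> [a x] [b y] [c z]; congr pair; rewrite /= ?mulrA //.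
by rewrite !mulrzDl -!mulrzA addrA (mulrC b a) (mulrC c a).
Qed.

Lemma sqz_mulC : commutative sqz_mul.
Proof. by move=> [a x] [b y]; congr pair; rewrite /= 1?mulrC 1?addrC. Qed.

Lemma sqz_mul1 : left_id sqz_one sqz_mul.
Proof. by move=> [a x]; rewrite /sqz_mul /= mul1r mulr1z mul0rz addr0. Qed.

Lemma sqz_mulDl : left_distributive sqz_mul +%R.
Proof.
move=> [a x] [b y] [c z]; congr pair; rewrite /= ?mulrDl //.
by rewrite mulrzDl mulrzDr addrACA.
Qed.

Lemma sqz_one_neq0 : sqz_one != 0.
Proof. by []. Qed.

HB.instance Definition _ := GRing.Zmodule_isComNzRing.Build (sqzero V)
  sqz_mulA sqz_mulC sqz_mul1 sqz_mulDl sqz_one_neq0.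

Definition sqz (v : V) : sqzero V := (0, v).

Lemma sqz_inj : injective sqz.
Proof. by move=> u v []. Qed.

Lemma sqzD : {morph sqz : u v / u + v}.
Proof. by move=> u v; congr pair; rewrite addr0. Qed.

Lemma sqzN : {morph sqz : u / - u}.
Proof. by move=> u; congr pair; rewrite oppr0. Qed.

Lemma sqz0 : sqz 0 = 0.
Proof. by []. Qed.

Lemma sqzMn n : {morph sqz : u / u *+ n}.
Proof.
move=> u; elim: n => [|n IHn]; first by rewrite !mulr0n.
by rewrite !mulrS sqzD IHn.
Qed.

End SquareZero.

Ltac abel := apply: sqz_inj; rewrite ?(sqzD, sqzN, sqz0, sqzMn); ring.

Lemma countable_enum (T : Type) (X : set T) : countable X -> X !=set0 ->
  exists f : nat -> T, (forall n, X (f n)) /\ forall x, X x -> exists n, f n = x.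
Proof.
move=> /pfcard_geP[-> [x]//|[f]] _; exists f; split=> [n|x].
  exact: (@funS _ _ _ _ f n I).
by move=> /(@surj _ _ _ _ f)[n _ <-]; exists n.
Qed.

Lemma complex_gt0_real (R : realType) (e : R[i]) :
  0 < e -> exists2 k : R, 0 < k & e = k%:C%C.
Proof.
move=> e0; exists (complex.Re e); last by rewrite RRe_real // gtr0_real.
by move: e0; rewrite ltcE => /andP[].
Qed.

Section CStarAlgebra.
Variables (R : realType) (A : cstarAlgType R).
Implicit Types (a b c h p q r t v x y z : A) (e : R).

Local Notation "a ⋅ b" := (cmul a b) (at level 40, left associativity).

Lemma cmul0l a : 0 ⋅ a = 0.
Proof. by apply: (addrI (0 ⋅ a)); rewrite -cmulDl !addr0. Qed.

Lemma cmul0r a : a ⋅ 0 = 0.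
Proof. by apply: (addrI (a ⋅ 0)); rewrite -cmulDr !addr0. Qed.

Lemma cmulNl a b : (- a) ⋅ b = - (a ⋅ b).
Proof. by apply: (addrI (a ⋅ b)); rewrite -cmulDl !addrN cmul0l. Qed.

Lemma cmulNr a b : a ⋅ (- b) = - (a ⋅ b).
Proof. by apply: (addrI (a ⋅ b)); rewrite -cmulDr !addrN cmul0r. Qed.

Lemma cmulMnl n a b : (a *+ n) ⋅ b = (a ⋅ b) *+ n.
Proof. by elim: n => [|n IHn]; rewrite ?cmul0l // !mulrS cmulDl IHn. Qed.

Lemma cmulMnr n a b : a ⋅ (b *+ n) = (a ⋅ b) *+ n.
Proof. by elim: n => [|n IHn]; rewrite ?cmul0r // !mulrS cmulDr IHn. Qed.

Lemma cstar0 : cstar (0 : A) = 0.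
Proof. by apply: (addrI (cstar 0)); rewrite -cstarD !addr0. Qed.

Lemma cstarN a : cstar (- a) = - cstar a.
Proof. by apply: (addrI (cstar a)); rewrite -cstarD !addrN cstar0. Qed.

Lemma cstarMn n a : cstar (a *+ n) = cstar a *+ n.
Proof. by elim: n => [|n IHn]; rewrite ?cstar0 // !mulrS cstarD IHn. Qed.

Definition cexpand := (@cmulDl R A, @cmulDr R A, cmulNl, cmulNr, cmulMnl,
  cmulMnr, cmul0l, cmul0r, @cmulA R A).
Definition sexpand := (@cstarD R A, cstarN, cstarMn, cstar0, @cstarM R A).

Definition nrm a : R := complex.Re `|a|.

Lemma nrmE a : `|a| = (nrm a)%:C%C.
Proof. by rewrite /nrm RRe_real // ger0_real. Qed.

Lemma nrm_ge0 a : 0 <= nrm a.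
Proof. by rewrite -ler0c -nrmE. Qed.
#[local] Hint Extern 0 (is_true (0 <= nrm _)) => exact: nrm_ge0 : core.

Lemma nrm0 : nrm 0 = 0.
Proof. by rewrite /nrm normr0. Qed.

Lemma nrm_eq0 a : nrm a <= 0 -> a = 0.
Proof.
move=> a0; apply/normr0_eq0; rewrite nrmE; congr (_%:C)%C.
by apply/le_anti; rewrite a0 nrm_ge0.
Qed.

Lemma nrmN a : nrm (- a) = nrm a.
Proof. by rewrite /nrm normrN. Qed.

Lemma nrmD a b : nrm (a + b) <= nrm a + nrm b.
Proof. by rewrite -lecR rmorphD /= -!nrmE ler_normD. Qed.

Lemma nrmB a b : nrm (a - b) <= nrm a + nrm b.
Proof. by rewrite -(nrmN b) nrmD. Qed.

Lemma nrmBC a b : nrm (a - b) = nrm (b - a).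
Proof. by rewrite -nrmN opprB. Qed.

Lemma nrmM a b : nrm (a ⋅ b) <= nrm a * nrm b.
Proof. by rewrite -lecR rmorphM /= -!nrmE cnormM. Qed.

Lemma nrmZ (k : R) a : 0 <= k -> nrm (k%:C%C *: a) = k * nrm a.
Proof.
move=> k0; apply: complexI; rewrite rmorphM /= -!nrmE normrZ ger0_norm //.
by rewrite ler0c.
Qed.

Lemma nrm_starM a : nrm (cstar a ⋅ a) = nrm a ^+ 2.
Proof. by apply: complexI; rewrite rmorphXn /= -!nrmE cnorm_star. Qed.

Lemma nrm_star a : nrm (cstar a) = nrm a.
Proof.
suff H b : nrm b <= nrm (cstar b).
  by apply/le_anti; rewrite H andbT -{2}(cstarK a) H.
have [->|b0] := eqVneq (nrm b) 0; first exact: nrm_ge0.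
have: nrm b ^+ 2 <= nrm (cstar b) * nrm b by rewrite -nrm_starM nrmM.
by rewrite expr2 ler_pM2r // lt_def b0 nrm_ge0.
Qed.

Lemma nrm_Mstar a : nrm (a ⋅ cstar a) = nrm a ^+ 2.
Proof. by rewrite -{1}(cstarK a) nrm_starM nrm_star. Qed.

Lemma nrmM_le a b (s t : R) : nrm a <= s -> nrm b <= t -> nrm (a ⋅ b) <= s * t.
Proof. by move=> ha hb; apply: le_trans (nrmM _ _) _; apply: ler_pM. Qed.

Lemma nrmMn n a : nrm (a *+ n) = nrm a *+ n.
Proof.
rewrite -[a *+ n]scaler_nat -[n%:R](rmorph_nat (real_complex R)) nrmZ ?ler0n //.
by rewrite mulr_natl.
Qed.

Lemma nrm_complete (x : nat -> A) :
    (forall e, 0 < e -> exists N, forall m n,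
       (N <= m)%N -> (N <= n)%N -> nrm (x m - x n) <= e) ->
  exists l, forall e, 0 < e ->
    exists N, forall n, (N <= n)%N -> nrm (x n - l) <= e.
Proof.
move=> xC.
have: cvg (x @ \oo).
  apply/cauchy_cvgP/cauchy_exP => e /complex_gt0_real[k k0 ->].
  have [N HN] := xC (k / 2) ltac:(lra).
  exists (x N), N => // n /= Nn.
  rewrite -ball_normE /= nrmE ltcR; have := HN N n (leqnn N) Nn; lra.
move=> /cvgrPdist_le xl; exists (lim (x @ \oo)) => e e0.
have [N _ HN] := xl e%:C%C ltac:(by rewrite -[0]/(0%:C%C) ltcR).
by exists N => n Nn; have := HN n Nn; rewrite nrmE lecR nrmBC.
Qed.

(* The hypothesis says that [p + i (1 - r)] is a unitary of the unitization. *)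
Lemma unitary_parts p r : cstar p = p -> cstar r = r -> p ⋅ r = r ⋅ p ->
  p ⋅ p = r *+ 2 - r ⋅ r ->
  [/\ nrm p <= 1 & forall y, nrm (y - r ⋅ y) <= nrm y].
Proof.
move=> ps rs pr pp.
have cross y : cstar (p ⋅ y) ⋅ (y - r ⋅ y) = cstar (y - r ⋅ y) ⋅ (p ⋅ y).
  rewrite !sexpand ps rs !cexpand -!(cmulA (cstar y)) pr; abel.
have squares y : cstar (p ⋅ y) ⋅ (p ⋅ y) +
    cstar (y - r ⋅ y) ⋅ (y - r ⋅ y) = cstar y ⋅ y.
  rewrite !sexpand ps rs !cexpand -(cmulA (cstar y) p) pp.
  rewrite -(cmulA (cstar y) r r) !cexpand; abel.
have iso (k : R[i]) y : (k^*)%R = - k -> k * k = -1 ->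
    nrm (p ⋅ y + k *: (y - r ⋅ y)) = nrm y.
  move=> kJ kk; apply/eqP; rewrite -(@eqrXn2 _ 2) // -!nrm_starM.
  rewrite -(squares y); apply/eqP; congr nrm.
  rewrite cstarD cstarZ kJ [in LHS]cmulDl !(cmulDr (cstar (p ⋅ y))).
  rewrite cmulDr !cmulZl !cmulZr cross scalerA mulNr kk opprK scale1r scaleNr.
  by rewrite addrA addrK.
have ii : 'i * 'i = -1 :> R[i] by rewrite -expr2 sqrCi.
have iso1 y : nrm (p ⋅ y + 'i *: (y - r ⋅ y)) = nrm y.
  by apply: iso => //; exact: conjCi.
have iso2 y : nrm (p ⋅ y - 'i *: (y - r ⋅ y)) = nrm y.
  rewrite -scaleNr; apply: iso; rewrite ?mulrNN //.
  by rewrite [LHS]rmorphN; congr (- _); exact: conjCi.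
have N1 y : nrm (p ⋅ y) <= nrm y.
  have : nrm (p ⋅ y *+ 2) <= nrm y + nrm y.
    rewrite -{1}(iso1 y) -(iso2 y); apply: le_trans (nrmD _ _).
    rewrite le_eqVlt; apply/orP.
    by left; apply/eqP; congr nrm; abel.
  rewrite nrmMn; lra.
have N2 y : nrm (y - r ⋅ y) <= nrm y.
  have : nrm ('i *: (y - r ⋅ y) *+ 2) <= nrm y + nrm y.
    rewrite -{1}(iso1 y) -(iso2 y); apply: le_trans (nrmB _ _).
    rewrite le_eqVlt; apply/orP.
    by left; apply/eqP; congr nrm; abel.
  rewrite nrmMn.
  have -> : nrm ('i *: (y - r ⋅ y)) = nrm (y - r ⋅ y).
    by rewrite /nrm normrZ normCi mul1r.
  lra.
split=> //; have := N1 p; rewrite -{1}ps nrm_starM expr2.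
have [->|p0] := eqVneq (nrm p) 0; first by rewrite ler01.
by rewrite ger_pMl // lt_def p0 nrm_ge0.
Qed.

(** * Square roots near 1 *)

Definition rate n : R := n.+2%:R^-1.

Lemma rate_small (x K : R) : (forall n, x <= K * rate n) -> x <= 0.
Proof.
move=> H; rewrite leNgt /rate; apply/negP => x0.
have K0 : 0 < K.
  by have := lt_le_trans x0 (H 0); rewrite pmulr_lgt0 ?invr_gt0.
have := H (Num.truncn (K / x)); rewrite ler_pdivlMr // => H1.
have : K / x < (Num.truncn (K / x)).+1%:R by exact: truncnS_gt.
rewrite ltr_pdivrMr // mulrC => H2.
by have := le_lt_trans H1 H2; rewrite ltr_pM2l // ltr_nat ltnNge leqnSn.
Qed.

Lemma rate_gt0 n : 0 < rate n.
Proof. by rewrite /rate invr_gt0. Qed.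

Lemma rate_le m n : (m <= n)%N -> rate n <= rate m.
Proof. by move=> mn; rewrite /rate lef_pV2 ?posrE // ler_nat !ltnS. Qed.

Lemma rate_ltS n : rate n.+1 < rate n.
Proof. by rewrite /rate ltf_pV2 ?posrE // ltr_nat. Qed.

Lemma rate_lt e : 0 < e -> exists n, rate n <= e.
Proof.
move=> e0; apply: contrapT => /forallNP H; suff: e <= 0 by rewrite leNgt e0.
apply: (rate_small (K := 1)) => n; rewrite mul1r.
by have /negP := H n; rewrite -ltNge => /ltW.
Qed.

Lemma telescope_lim (x : nat -> A) (s : nat -> R) :
    (forall n, 0 <= s n <= rate n) ->
    (forall n, nrm (x n.+1 - x n) <= s n - s n.+1) ->
  exists l, forall n, nrm (x n - l) <= s n.
Proof.
move=> sr xs.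
have dist m n : (m <= n)%N -> nrm (x n - x m) <= s m - s n.
  elim: n => [|n IHn]; first by rewrite leqn0 => /eqP ->; rewrite !subrr nrm0.
  rewrite leq_eqVlt => /predU1P[->|mn]; first by rewrite !subrr nrm0.
  have := IHn mn; have := xs n.
  have := nrmD (x n.+1 - x n) (x n - x m).
  rewrite addrA subrK; lra.
have [|l ly] := nrm_complete (x := x).
  move=> e /rate_lt[N Ne]; exists N => m n.
  wlog mn : m n / (n <= m)%N => [H Nm Nn|Nm Nn].
    by have [/H|/ltnW/H] := leqP n m; [exact|rewrite nrmBC; exact].
  apply: le_trans (dist _ _ mn) _.
  have /andP[_ sn] := sr n; have /andP[sm _] := sr m.
  have := rate_le Nn; lra.
exists l => n; apply/ler_addgt0Pr => e /ly[N HN].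
pose m := maxn n N.
have := HN m (leq_maxr _ _); have := dist _ _ (leq_maxl n N).
have /andP[sm _] := sr m.
have := nrmD (x n - x m) (x m - l).
rewrite addrA subrK (nrmBC _ (x m)) -/m; lra.
Qed.

Fixpoint qbound n : R := if n is m.+1 then 1 / 4 + qbound m ^+ 2 else 0.

Lemma qboundP n : 0 <= qbound n /\ 1 / 2 - qbound n <= rate n /\
  qbound n <= 1 / 2.
Proof.
rewrite /rate; elim: n => [|n [t0 [tn t2]]] /=; first by split=> //; split; lra.
have tt0 := sqr_ge0 (qbound n).
have tt1 : qbound n ^+ 2 <= 1 / 4 by rewrite expr2; nra.
split; first lra; split; last lra.
set m := n.+2%:R in tn *; have m2 : 2 <= m by rewrite /m ler_nat.
have -> : n.+3%:R = m + 1 :> R by rewrite -natr1.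
have mV : m * m^-1 = 1 by rewrite mulfV //; lra.
have mV2 : m^-1 <= 1 / 2.
  by rewrite div1r lef_pV2 // posrE; lra.
have mV0 : 0 < m^-1 by rewrite invr_gt0; lra.
rewrite -[leRHS]div1r; move: (m^-1) mV mV2 mV0 tn => s mV mV2 mV0 tn.
apply: (@le_trans _ _ (s - s ^+ 2)).
  have : 0 <= (s - (1 / 2 - qbound n)) * (1 - s - (1 / 2 - qbound n)).
    by apply: mulr_ge0; lra.
  by rewrite !expr2; lra.
rewrite ler_pdivlMr; last lra.
have -> : (s - s ^+ 2) * (m + 1) = m * s + s - m * s * s - s * s by ring.
by rewrite mV; nra.
Qed.

Fixpoint qiter c n : A := if n is m.+1 then c + qiter c m ⋅ qiter c m else 0.

Section QuarterBall.
Variable c : A.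
Hypothesis c4 : nrm c <= 1 / 4.

Lemma qiter_le n : nrm (qiter c n) <= qbound n.
Proof.
elim: n => [|n IHn] /=; first by rewrite nrm0.
apply: le_trans (nrmD _ _) _; rewrite lerD // expr2.
by apply: nrmM_le.
Qed.

Lemma qiter_half n : nrm (qiter c n) <= 1 / 2.
Proof. by apply: le_trans (qiter_le n) _; have [_ []] := qboundP n. Qed.

Lemma qiterS_dist n :
  nrm (qiter c n.+1 - qiter c n) <= qbound n.+1 - qbound n.
Proof.
elim: n => [|n IHn].
  by rewrite /= cmul0l !addr0 subr0 expr0n /= addr0 subr0.
rewrite [qiter c n.+2]/= [qbound n.+2]/=.
set x := qiter c n.+1; set y := qiter c n.
have -> : c + x ⋅ x - x = x ⋅ (x - y) + (x - y) ⋅ y.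
  have cE : c = x - y ⋅ y by rewrite /x /= addrK.
  rewrite !cexpand {1}cE; abel.
apply: le_trans (nrmD _ _) _.
have h1 := nrmM_le (qiter_le n.+1) IHn.
have h2 := nrmM_le IHn (qiter_le n).
apply: le_trans (lerD h1 h2) _; rewrite le_eqVlt; apply/orP; left.
by apply/eqP; rewrite /=; field.
Qed.

Lemma qiter_lim : exists y, forall n, nrm (qiter c n - y) <= rate n.
Proof.
have [n||y yP] := telescope_lim (x := qiter c) (s := fun n => 1 / 2 - qbound n).
- by have [_ [h1 h2]] := qboundP n; rewrite h1 andbT; lra.
- by move=> n; have := qiterS_dist n; lra.
- by exists y => n; apply: le_trans (yP n) _; have [_ []] := qboundP n.
Qed.

Lemma qiter_star n : cstar c = c -> cstar (qiter c n) = qiter c n.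
Proof. by move=> cs; elim: n => [|n IHn] /=; rewrite !sexpand ?cs ?IHn. Qed.

Lemma qiter_comm x n : x ⋅ c = c ⋅ x -> x ⋅ qiter c n = qiter c n ⋅ x.
Proof.
move=> xc; elim: n => [|n IHn] /=; rewrite !cexpand //.
by rewrite xc IHn -cmulA IHn cmulA.
Qed.

End QuarterBall.

Lemma qiter_lip c d n : nrm c <= 1 / 4 -> nrm d <= 1 / 4 ->
  nrm (qiter c n - qiter d n) <= n%:R * nrm (c - d).
Proof.
move=> c4 d4; elim: n => [|n IHn]; first by rewrite /= subrr nrm0 mul0r.
rewrite [qiter c _]/= [qiter d _]/=.
set x := qiter c n in IHn *; set y := qiter d n in IHn *.
have -> : c + x ⋅ x - (d + y ⋅ y) = (c - d) + (x ⋅ (x - y) + (x - y) ⋅ y).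
  by rewrite !cexpand; abel.
have := nrmM_le (qiter_half c4 n) IHn; have := nrmM_le IHn (qiter_half d4 n).
rewrite -/x -/y -[n.+1%:R]natr1 mulrDl mul1r.
have := nrmD (x ⋅ (x - y)) ((x - y) ⋅ y).
have := nrmD (c - d) (x ⋅ (x - y) + (x - y) ⋅ y).
lra.
Qed.

(* [halfroot c] is [(1 - sqrt (1 - 4 c)) / 2]. *)
Definition halfroot c : A :=
  xget 0 [set y | forall n, nrm (qiter c n - y) <= rate n].

Section HalfRoot.
Variable c : A.
Hypothesis c4 : nrm c <= 1 / 4.

Lemma halfroot_approx n : nrm (qiter c n - halfroot c) <= rate n.
Proof.
by rewrite /halfroot; case: xgetP n => // H; have [y /H] := qiter_lim c4.
Qed.

Lemma halfroot_half : nrm (halfroot c) <= 1 / 2.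
Proof.
rewrite -subr_le0; apply: (rate_small (K := 1)) => n.
have := halfroot_approx n; have := qiter_half c4 n.
have := nrmB (qiter c n) (qiter c n - halfroot c).
by rewrite opprB addrCA subrr addr0 mul1r; lra.
Qed.

Lemma halfrootE : halfroot c = c + halfroot c ⋅ halfroot c.
Proof.
apply/eqP; rewrite -subr_eq0; apply/eqP/nrm_eq0/(rate_small (K := 2)) => n.
set l := halfroot c; have h1 := halfroot_approx n.+1.
have h2 := halfroot_approx n.
have -> : l - (c + l ⋅ l) = - (qiter c n.+1 - l) +
    (qiter c n ⋅ (qiter c n - l) + (qiter c n - l) ⋅ l).
  by rewrite /= !cexpand; abel.
have := nrmM_le (qiter_half c4 n) h2; have := nrmM_le h2 halfroot_half.
have := nrmD (qiter c n ⋅ (qiter c n - l)) ((qiter c n - l) ⋅ l).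
have := nrmD (- (qiter c n.+1 - l))
  (qiter c n ⋅ (qiter c n - l) + (qiter c n - l) ⋅ l).
rewrite nrmN -/l; move: h1 h2; rewrite -/l.
have := rate_ltS n; lra.
Qed.

Lemma halfroot_star : cstar c = c -> cstar (halfroot c) = halfroot c.
Proof.
move=> cs; apply/eqP; rewrite -subr_eq0; apply/eqP/nrm_eq0.
apply: (rate_small (K := 2)) => n; have := halfroot_approx n.
have := nrmB (qiter c n - halfroot c) (cstar (qiter c n - halfroot c)).
rewrite nrm_star !sexpand qiter_star //.
have -> (x y z : A) : x - y - (x + - z) = z - y by abel.
lra.
Qed.

Lemma halfroot_comm x : x ⋅ c = c ⋅ x -> x ⋅ halfroot c = halfroot c ⋅ x.
Proof.
move=> xc; apply/eqP; rewrite -subr_eq0; apply/eqP/nrm_eq0.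
apply: (rate_small (K := (nrm x + nrm x))) => n; have h := halfroot_approx n.
set l := halfroot c in h *.
have -> : x ⋅ l - l ⋅ x = (qiter c n - l) ⋅ x - x ⋅ (qiter c n - l).
  by rewrite !cexpand (qiter_comm _ xc); abel.
have := nrmM_le h (lexx (nrm x)); have := nrmM_le (lexx (nrm x)) h.
have := nrmB ((qiter c n - l) ⋅ x) (x ⋅ (qiter c n - l)).
by rewrite (mulrC _ (nrm x)) mulrDl; lra.
Qed.

End HalfRoot.

Lemma halfroot_cont c d n : nrm c <= 1 / 4 -> nrm d <= 1 / 4 ->
  nrm (halfroot c - halfroot d) <= 2 * rate n + n%:R * nrm (c - d).
Proof.
move=> c4 d4; have := halfroot_approx c4 n; have := halfroot_approx d4 n.
have := qiter_lip n c4 d4.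
set u := qiter c n; set v := qiter d n.
have := nrmD (u - v) ((v - halfroot d) - (u - halfroot c)).
have := nrmB (v - halfroot d) (u - halfroot c).
have -> : u - v + (v - halfroot d - (u - halfroot c)) =
  halfroot c - halfroot d by abel.
lra.
Qed.

(** * Functions of self-adjoint contractions *)

Definition half a : A := (2^-1)%:C%C *: a.

Lemma halfK a : half a *+ 2 = a.
Proof.
rewrite /half scalerMnl -rmorphMn /= -mulr_natr mulVf ?pnatr_eq0 //.
by rewrite rmorph1 scale1r.
Qed.

Lemma nrm_half a : nrm (half a) = nrm a / 2.
Proof. by have := nrmMn 2 (half a); rewrite halfK; lra. Qed.

Lemma double_inj : injective (fun a : A => a *+ 2).
Proof.
move=> a b ab; apply/eqP; rewrite -subr_eq0; apply/eqP/nrm_eq0.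
have := nrmMn 2 (a - b); rewrite mulrnBl ab subrr nrm0; lra.
Qed.

Lemma halfD : {morph half : a b / a + b}.
Proof. by move=> a b; rewrite /half scalerDr. Qed.

Lemma halfN : {morph half : a / - a}.
Proof. by move=> a; rewrite /half scalerN. Qed.

Lemma half_star a : cstar (half a) = half (cstar a).
Proof. by apply: double_inj; rewrite /= -cstarMn !halfK. Qed.

Lemma cmul_halfl a b : half a ⋅ b = half (a ⋅ b).
Proof. by rewrite /half cmulZl. Qed.

Lemma cmul_halfr a b : a ⋅ half b = half (a ⋅ b).
Proof. by rewrite /half cmulZr. Qed.

(* In the unitization, [1 - z] is a square root of [1 - h ^ 2]. *)
Lemma cosine h : cstar h = h -> nrm h <= 1 ->
  exists z, [/\ cstar z = z, z ⋅ z = z *+ 2 - h ⋅ h, z ⋅ h = h ⋅ z &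
    nrm z <= 1].
Proof.
move=> hs h1; pose c := half (half (h ⋅ h)).
have c4 : nrm c <= 1 / 4.
  by rewrite /c !nrm_half; have := nrmM_le h1 h1; lra.
have yE := halfrootE c4; set y := halfroot c in yE.
have hh : h ⋅ h = (y - y ⋅ y) *+ 4.
  by rewrite {1}yE addrK /c -[4%N]/(2 * 2)%N mulrnA !halfK.
exists (y *+ 2); split.
- rewrite cstarMn halfroot_star // /c !half_star cstarM hs //.
- by rewrite hh !cexpand; abel.
- rewrite !cexpand (halfroot_comm c4) // /c.
  by rewrite !(cmul_halfl, cmul_halfr) cmulA.
- by rewrite nrmMn; have := halfroot_half c4; rewrite -/y; lra.
Qed.

Section Angles.
Variables h z : A.
Hypotheses (hs : cstar h = h) (zs : cstar z = z).
Hypotheses (zz : z ⋅ z = z *+ 2 - h ⋅ h) (zh : z ⋅ h = h ⋅ z).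

Let zhx x : x ⋅ z ⋅ h = x ⋅ h ⋅ z.
Proof. by rewrite -!cmulA zh. Qed.

Let zzx x : x ⋅ z ⋅ z = (x ⋅ z) *+ 2 - x ⋅ h ⋅ h.
Proof. by rewrite -cmulA zz !cexpand. Qed.

Lemma cosine_contraction y : nrm (y - z ⋅ y) <= nrm y.
Proof.
have [//|_ ->//] := unitary_parts hs zs (esym zh).
by rewrite zz; abel.
Qed.

Lemma double_angle : nrm ((h - h ⋅ z) *+ 2) <= 1.
Proof.
have [||||->//] := unitary_parts (p := (h - h ⋅ z) *+ 2) (r := (h ⋅ h) *+ 2).
- by rewrite !sexpand hs zs zh.
- by rewrite !sexpand hs.
- by rewrite !(cexpand, zhx, zzx, zz, zh); abel.
- by rewrite !(cexpand, zhx, zzx, zz, zh); abel.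
Qed.

Lemma triple_angle : nrm (h *+ 3 - (h ⋅ h ⋅ h) *+ 4) <= 1.
Proof.
have [||||->//] := unitary_parts (p := h *+ 3 - (h ⋅ h ⋅ h) *+ 4)
  (r := (h ⋅ h) *+ 4 + z - (h ⋅ h ⋅ z) *+ 4).
- by rewrite !sexpand hs cmulA.
- by rewrite !sexpand hs zs !(cexpand, zhx, zh).
- by rewrite !(cexpand, zhx, zzx, zz, zh); abel.
- by rewrite !(cexpand, zhx, zzx, zz, zh); abel.
Qed.

End Angles.

(* The polynomial [(3 t - t ^ 3) / 2], which maps [-2, 2] into [-1, 1] and
   fixes 0 and 1. *)
Definition clip t : A := half t *+ 3 - (half t ⋅ half t ⋅ half t) *+ 4.

Lemma clip_star t : cstar t = t -> cstar (clip t) = clip t.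
Proof. by move=> ts; rewrite /clip !sexpand !half_star ts cmulA. Qed.

Lemma clip_le1 t : cstar t = t -> nrm t <= 2 -> nrm (clip t) <= 1.
Proof.
move=> ts t2; have hs : cstar (half t) = half t by rewrite half_star ts.
have [|z [zs zz zh _]] := cosine hs; first by rewrite nrm_half; lra.
exact: triple_angle hs zs zz zh.
Qed.

Lemma clip_right x t : nrm t <= 2 -> nrm (x - x ⋅ clip t) <= 4 * nrm (x - x ⋅ t).
Proof.
move=> t2; have h1 : nrm (half t) <= 1 by rewrite nrm_half; lra.
set h := half t in h1 *; set r := x - x ⋅ t.
have -> : x - x ⋅ clip t = r - (r ⋅ h + (r ⋅ h ⋅ h) *+ 2).
  by rewrite /clip -/h /r -(halfK t) -/h !cexpand; abel.
have h2 := nrmM_le (lexx (nrm r)) h1; have h3 := nrmM_le h2 h1.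
have := nrmB r (r ⋅ h + (r ⋅ h ⋅ h) *+ 2).
have := nrmD (r ⋅ h) ((r ⋅ h ⋅ h) *+ 2).
rewrite nrmMn; lra.
Qed.

Lemma clip_left t q : t ⋅ q = t -> clip t ⋅ q = clip t.
Proof.
move=> tq; have hq : half t ⋅ q = half t by rewrite cmul_halfl tq.
by rewrite /clip !cexpand -!cmulA hq.
Qed.

Lemma clip_lip t u : nrm t <= 2 -> nrm u <= 2 ->
  nrm (clip t - clip u) <= 8 * nrm (t - u).
Proof.
move=> t2 u2; rewrite /clip; set h := half t; set k := half u.
have h1 : nrm h <= 1 by rewrite nrm_half; lra.
have k1 : nrm k <= 1 by rewrite nrm_half; lra.
have hk : nrm (h - k) = nrm (t - u) / 2 by rewrite -halfN -halfD nrm_half.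
have -> : h *+ 3 - (h ⋅ h ⋅ h) *+ 4 - (k *+ 3 - (k ⋅ k ⋅ k) *+ 4) =
    (h - k) *+ 3 -
    ((h - k) ⋅ (h ⋅ h) + (k ⋅ (h - k) ⋅ h + (k ⋅ k) ⋅ (h - k))) *+ 4.
  by rewrite !cexpand; abel.
have h2 := nrmM_le (lexx (nrm (h - k))) (nrmM_le h1 h1).
have h3 := nrmM_le (nrmM_le k1 (lexx (nrm (h - k)))) h1.
have h4 := nrmM_le (nrmM_le k1 k1) (lexx (nrm (h - k))).
set a := (h - k) ⋅ _ in h2 *; set b := k ⋅ (h - k) ⋅ h in h3 *.
set c := (k ⋅ k) ⋅ _ in h4 *.
have := nrmB ((h - k) *+ 3) ((a + (b + c)) *+ 4); rewrite !nrmMn.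
have := nrmD a (b + c); have := nrmD b c; have := nrm_ge0 (t - u); lra.
Qed.

(* On [0, 1] these are clipped versions of [max (2 v ^ 2 - 1) 0] (for
   [s = false]) and [min (2 v ^ 2) 1] (for [s = true]): here
   [1 - 2 * halfroot (v ^ 2 - v ^ 4) = |1 - 2 v ^ 2|]. *)
Definition ramp (s : bool) v : A :=
  clip (v ⋅ v + (if s then id else -%R) (halfroot (v ⋅ v - v ⋅ v ⋅ v ⋅ v))).

Lemma nrm_sign (s : bool) x : nrm ((if s then id else -%R) x) = nrm x.
Proof. by case: s; rewrite ?nrmN. Qed.

Section Cut.
Variable v : A.
Hypotheses (vs : cstar v = v) (v1 : nrm v <= 1).

Let c := v ⋅ v - v ⋅ v ⋅ v ⋅ v.

Lemma ramp_arg4 : nrm c <= 1 / 4.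
Proof.
have [z [zs zz zh _]] := cosine vs v1.
have := double_angle vs zs zz zh; rewrite nrmMn => k2.
have -> : c = (v - v ⋅ z) ⋅ (v - v ⋅ z).
  have zhx x : x ⋅ z ⋅ v = x ⋅ v ⋅ z by rewrite -!cmulA zh.
  have zzx x : x ⋅ z ⋅ z = (x ⋅ z) *+ 2 - x ⋅ v ⋅ v.
    by rewrite -cmulA zz !cexpand.
  by rewrite /c !(cexpand, zhx, zzx, zz, zh); abel.
have k1 : nrm (v - v ⋅ z) <= 1 / 2 by lra.
by have := nrmM_le k1 k1; lra.
Qed.

Lemma ramp_arg_star : cstar c = c.
Proof. by rewrite /c !sexpand vs !cmulA. Qed.

Lemma ramp_unclipped_le2 (s : bool) :
  nrm (v ⋅ v + (if s then id else -%R) (halfroot c)) <= 2.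
Proof.
apply: le_trans (nrmD _ _) _; rewrite nrm_sign.
have := nrmM_le v1 v1; have := halfroot_half ramp_arg4; lra.
Qed.

Lemma ramp_unclipped_star (s : bool) :
  let w := v ⋅ v + (if s then id else -%R) (halfroot c) in cstar w = w.
Proof.
have yE := halfroot_star ramp_arg4 ramp_arg_star.
by case: s; rewrite /= !sexpand yE vs.
Qed.

Lemma ramp_star s : cstar (ramp s v) = ramp s v.
Proof. by rewrite /ramp clip_star // ramp_unclipped_star. Qed.

Lemma ramp_le1 s : nrm (ramp s v) <= 1.
Proof.
by rewrite /ramp clip_le1 ?ramp_unclipped_star ?ramp_unclipped_le2.
Qed.

Lemma ramp_right s x : nrm (x - x ⋅ ramp s v) <= 24 * nrm (x - x ⋅ v).
Proof.
apply: le_trans (clip_right _ (ramp_unclipped_le2 s)) _.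
set y := halfroot c; set n := nrm (x - x ⋅ v).
have h1 : nrm (x - x ⋅ (v ⋅ v)) <= 2 * n.
  have -> : x - x ⋅ (v ⋅ v) = (x - x ⋅ v) + (x - x ⋅ v) ⋅ v.
    by rewrite !cexpand; abel.
  by have := nrmD (x - x ⋅ v) ((x - x ⋅ v) ⋅ v);
    have := nrmM_le (lexx n) v1; rewrite -/n; lra.
have h2 : nrm (x ⋅ c) <= 2 * n.
  have -> : x ⋅ c = (x - x ⋅ (v ⋅ v)) ⋅ (v ⋅ v) by rewrite /c !cexpand.
  by have := nrmM_le h1 (nrmM_le v1 v1); lra.
have h3 : nrm (x ⋅ y) <= 4 * n.
  have := nrmD (x ⋅ c) (x ⋅ y ⋅ y).
  rewrite -[x ⋅ y ⋅ y]cmulA -cmulDr -(halfrootE ramp_arg4) -/y cmulA.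
  have := nrmM_le (lexx (nrm (x ⋅ y))) (halfroot_half ramp_arg4).
  rewrite -/y; lra.
have -> : x - x ⋅ (v ⋅ v + (if s then id else -%R) y) =
    (x - x ⋅ (v ⋅ v)) - (if s then id else -%R) (x ⋅ y).
  by case: s; rewrite /= !cexpand; abel.
have := nrmB (x - x ⋅ (v ⋅ v)) ((if s then id else -%R) (x ⋅ y)).
rewrite nrm_sign; lra.
Qed.

Lemma ramp_right_id s x : x ⋅ v = x -> x ⋅ ramp s v = x.
Proof.
move=> xv; have := ramp_right s x; rewrite xv subrr nrm0 mulr0 => /nrm_eq0.
by move/eqP; rewrite subr_eq0 => /eqP.
Qed.

Lemma ramp_left s q : v ⋅ q = v -> ramp s v ⋅ q = ramp s v.
Proof.
move=> vq; apply: clip_left; set y := halfroot c.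
have cq : c ⋅ q = c by rewrite /c !cexpand -!(cmulA _ v q) vq.
have yq : y ⋅ q = y.
  apply/esym/eqP; rewrite -subr_eq0; apply/eqP/nrm_eq0.
  have dE : y - y ⋅ q = y ⋅ (y - y ⋅ q).
    move: (halfrootE ramp_arg4) cq; rewrite -/y; move: (c) => c' yE cq.
    by rewrite {1 2}yE !cexpand cq; abel.
  have := nrmM_le (halfroot_half ramp_arg4) (lexx (nrm (y - y ⋅ q))).
  rewrite -/y -dE; lra.
by case: s; rewrite /= !cexpand yq -cmulA vq.
Qed.

Lemma ramp_low_up : ramp false v ⋅ ramp true v = ramp false v.
Proof.
apply: clip_left; rewrite /= -/c; set y := halfroot c; set f := v ⋅ v - y.
have vy : v ⋅ y = y ⋅ v.
  by apply: (halfroot_comm ramp_arg4); rewrite /c !cexpand.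
have := halfrootE ramp_arg4; rewrite -/y => E.
have {E}yE : y ⋅ y = y - c by rewrite {3}E addrAC subrr add0r.
have fg : f ⋅ (v ⋅ v + y) = f.
  have vyx x : x ⋅ y ⋅ v = x ⋅ v ⋅ y by rewrite -!cmulA vy.
  by rewrite /f !(cexpand, vyx, esym vy, yE) /c; abel.
have := clip_right f (ramp_unclipped_le2 true).
rewrite /= -/c -/y fg subrr nrm0 mulr0 => /nrm_eq0 /eqP.
by rewrite subr_eq0 => /eqP.
Qed.

End Cut.

Lemma ramp_cont e : 0 < e -> exists2 d : R, 0 < d &
  forall s v u, cstar v = v -> nrm v <= 1 -> cstar u = u -> nrm u <= 1 ->
    nrm (v - u) <= d -> nrm (ramp s v - ramp s u) <= e.
Proof.
move=> e0; have [n rn] : exists n, rate n <= e / 32 by apply: rate_lt; lra.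
have n0 : 0 <= n%:R :> R by [].
exists (e / (2 * (16 + 48 * n%:R))); first by rewrite divr_gt0 //; lra.
move=> s v u vs v1 us u1; set d := _ / _ => vu.
have dE : (16 + 48 * n%:R) * d = e / 2 by rewrite /d; field; lra.
clearbody d; have h2 : nrm (v ⋅ v - u ⋅ u) <= 2 * d.
  have -> : v ⋅ v - u ⋅ u = v ⋅ (v - u) + (v - u) ⋅ u.
    by rewrite !cexpand; abel.
  have := nrmD (v ⋅ (v - u)) ((v - u) ⋅ u).
  by have := nrmM_le v1 vu; have := nrmM_le vu u1; lra.
have h4 : nrm (v ⋅ v ⋅ v ⋅ v - u ⋅ u ⋅ u ⋅ u) <= 4 * d.
  have -> : v ⋅ v ⋅ v ⋅ v - u ⋅ u ⋅ u ⋅ u =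
      (v ⋅ v) ⋅ (v ⋅ v - u ⋅ u) + (v ⋅ v - u ⋅ u) ⋅ (u ⋅ u).
    by rewrite !cexpand; abel.
  have := nrmD ((v ⋅ v) ⋅ (v ⋅ v - u ⋅ u)) ((v ⋅ v - u ⋅ u) ⋅ (u ⋅ u)).
  have := nrmM_le (nrmM_le v1 v1) h2; have := nrmM_le h2 (nrmM_le u1 u1); lra.
have := halfroot_cont n (ramp_arg4 vs v1) (ramp_arg4 us u1).
set c := v ⋅ v - _; set c' := u ⋅ u - _ => h5.
have h6 : nrm (c - c') <= 6 * d.
  have -> : c - c' = (v ⋅ v - u ⋅ u) - (v ⋅ v ⋅ v ⋅ v - u ⋅ u ⋅ u ⋅ u).
    by rewrite /c /c'; abel.
  by have := nrmB (v ⋅ v - u ⋅ u) (v ⋅ v ⋅ v ⋅ v - u ⋅ u ⋅ u ⋅ u); lra.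
have h7 : n%:R * nrm (c - c') <= n%:R * (6 * d) by rewrite ler_wpM2l.
have := clip_lip (ramp_unclipped_le2 vs v1 s) (ramp_unclipped_le2 us u1 s).
rewrite -/c -/c' -!/(ramp s _).
set y := halfroot c in h5 *; set y' := halfroot c' in h5 *.
have -> : v ⋅ v + (if s then id else -%R) y -
    (u ⋅ u + (if s then id else -%R) y') =
    (v ⋅ v - u ⋅ u) + (if s then id else -%R) (y - y').
  by case: s; rewrite /=; abel.
have := nrmD (v ⋅ v - u ⋅ u) ((if s then id else -%R) (y - y')).
rewrite nrm_sign; lra.
Qed.

(** * Absorbing sequences *)

Lemma ramp_low_cont e : 0 < e -> exists2 d : R, 0 < d <= e &
  forall x v u, nrm x <= 1 -> cstar v = v -> nrm v <= 1 ->
    cstar u = u -> nrm u <= 1 -> nrm (v - u) <= d ->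
    nrm (ramp false v ⋅ x ⋅ ramp false v - ramp false u ⋅ x ⋅ ramp false u) <= e.
Proof.
move=> e0; have [|d d0 dP] := ramp_cont (e := e / 2); first by lra.
exists (Num.min d e); first by rewrite lt_min d0 e0 ge_min lexx orbT.
move=> x v u x1 vs v1 us u1; rewrite le_min => /andP[vud _].
have := dP false _ _ vs v1 us u1 vud.
have := ramp_le1 vs v1 false; have := ramp_le1 us u1 false.
move: (ramp false v) (ramp false u) => p q q1 p1 pq.
have -> : p ⋅ x ⋅ p - q ⋅ x ⋅ q = (p - q) ⋅ x ⋅ p + q ⋅ x ⋅ (p - q).
  by rewrite !cexpand; abel.
have := nrmD ((p - q) ⋅ x ⋅ p) (q ⋅ x ⋅ (p - q)).
have := nrmM_le (nrmM_le pq x1) p1; have := nrmM_le (nrmM_le q1 x1) pq; lra.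
Qed.

(* The witness compresses [h ^ 2 + (1 - z) u (1 - z)], where [u] is some [e n]
   and [1 - z] a square root of [1 - h ^ 2]. *)
Lemma absorbing_step (e : nat -> A) b h (X : set A) (eps : R) :
    (forall n, cstar (e n) = e n /\ nrm (e n) <= 1) ->
    (forall Y : set A, finite_set Y -> forall d : R, 0 < d ->
      exists n, forall y, Y y -> nrm (y - y ⋅ e n) <= d) ->
    cstar h = h -> nrm h <= 1 -> b ⋅ h = b -> finite_set X -> 0 < eps ->
  exists v, [/\ cstar v = v, nrm v <= 1, b ⋅ v = b &
    forall x, X x -> nrm (x - x ⋅ v) <= eps].
Proof.
move=> e1 eX hs h1 bh Xfin eps0.
have [z [zs zz zh z1]] := cosine hs h1.
have [] := eX [set x - x ⋅ z | x in X] (finite_image _ Xfin) (eps / 8).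
  by rewrite divr_gt0.
move=> n en; have [us u1] := e1 n; move: (e n) us u1 en => u us u1 en.
have bz : b ⋅ z = b.
  apply/esym/eqP; rewrite -subr_eq0; apply/eqP/nrm_eq0.
  have : nrm (b - b ⋅ z) ^+ 2 = 0.
    rewrite -nrm_Mstar !sexpand zs -[RHS]nrm0; congr nrm.
    have bzz : b ⋅ z ⋅ z = (b ⋅ z) *+ 2 - b.
      by rewrite -cmulA zz !cexpand bh bh.
    by rewrite !cexpand bzz !cexpand; abel.
  by move/eqP; rewrite sqrf_eq0 => /eqP ->.
pose g := u - z ⋅ u; pose t := h ⋅ h + (g - g ⋅ z).
have ts : cstar t = t by rewrite /t /g !sexpand hs zs us !cexpand; abel.
have t2 : nrm t <= 2.
  have := nrmM_le h1 h1; have := cosine_contraction hs zs zz zh u; rewrite -/g.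
  have := cosine_contraction hs zs zz zh (cstar g).
  rewrite -nrm_star cstarD cstarN cstarM zs cstarK nrm_star.
  have := nrm_ge0 u; have := nrmD (h ⋅ h) (g - g ⋅ z); lra.
exists (clip t); split; [exact: clip_star | exact: clip_le1 | |].
  have := clip_right b t2; have -> : b ⋅ t = b.
    by rewrite /t /g !cexpand bh bh bz; abel.
  rewrite subrr nrm0 mulr0 => /nrm_eq0 /eqP.
  by rewrite subr_eq0 => /eqP.
move=> x Xx; apply: le_trans (clip_right x t2) _.
have := en (x - x ⋅ z) ltac:(by exists x); set r := _ - _ ⋅ u => rd.
have -> : x - x ⋅ t = r - r ⋅ z.
  have xzz : x ⋅ z ⋅ z = (x ⋅ z) *+ 2 - x ⋅ h ⋅ h.
    by rewrite -cmulA zz !cexpand.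
  by rewrite /r /t /g !cexpand xzz; abel.
have := nrmB r (r ⋅ z); have := nrmM_le rd z1; lra.
Qed.

Section Tower.
Variables (b z : nat -> A).
Hypothesis (bS : forall n, b n ⋅ b n.+1 = b n).
Hypothesis zP : forall n,
  [/\ cstar (z n) = z n, nrm (z n) <= 1 & b n ⋅ z n = b n].

Fixpoint tower d k : A :=
  if d is d'.+1 then
    ramp false (tower d' k.+1) ⋅ z k ⋅ ramp false (tower d' k.+1)
  else z k.

Lemma towerP d k :
  [/\ cstar (tower d k) = tower d k, nrm (tower d k) <= 1 &
    b k ⋅ tower d k = b k].
Proof.
elim: d k => [|d IHd] k //=; have [ts t1 bt] := IHd k.+1.
have [zs z1 bz] := zP k.
have cs := ramp_star ts t1 false; have c1 := ramp_le1 ts t1 false.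
have bc : b k ⋅ ramp false (tower d k.+1) = b k.
  by apply: ramp_right_id => //; rewrite -{1}bS -cmulA bt bS.
move: (ramp _ _) cs c1 bc => c cs c1 bc.
split; first by rewrite !cstarM cs zs !cmulA.
  by have := nrmM_le (nrmM_le c1 z1) c1; rewrite !mulr1.
by rewrite !cmulA bc bz bc.
Qed.

Lemma tower_absorbed d k :
  tower d.+1 k ⋅ ramp true (tower d k.+1) = tower d.+1 k.
Proof.
have [ts t1 _] := towerP d k.+1.
by rewrite /= -!cmulA ramp_low_up.
Qed.

Lemma tower_dist (kappa : R -> R) (s : nat -> R) :
    (forall n, 0 < s n) ->
    (forall e, 0 < e -> 0 < kappa e <= e /\
      forall x v u, nrm x <= 1 -> cstar v = v -> nrm v <= 1 ->
      cstar u = u -> nrm u <= 1 -> nrm (v - u) <= kappa e ->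
      nrm (ramp false v ⋅ x ⋅ ramp false v -
           ramp false u ⋅ x ⋅ ramp false u) <= e) ->
    (forall n, nrm (z n - z n ⋅ z n.+1) <= iter n kappa (s n) / 48) ->
  forall d k, nrm (tower d.+1 k - tower d k) <= s (k + d)%N.
Proof.
move=> s0 kP zS.
have iterP n e : 0 < e -> 0 < iter n kappa e <= e.
  move=> e0; elim: n => [|n /andP[i0 ie]]; first by rewrite /= e0 lexx.
  have [/andP[k0 ke] _] := kP _ i0.
  by rewrite /= k0 /=; exact: le_trans ke ie.
suff H d k : nrm (tower d.+1 k - tower d k) <= iter k kappa (s (k + d)%N).
  by move=> d k; apply: le_trans (H d k) _;
    have /andP[] := iterP k _ (s0 (k + d)%N).
elim: d k => [|d IHd] k.
  rewrite addn0 [tower 1 k]/= [tower 0 k]/=.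
  have [zs z1 _] := zP k; have [zs' z1' _] := zP k.+1.
  have := le_trans (ramp_right zs' z1' false (z k)) (ler_wpM2l _ (zS k)).
  have := ramp_star zs' z1' false; have := ramp_le1 zs' z1' false.
  move: (ramp _ _) => a a1 as_ /(_ (ler0n _ 24)) h.
  have h' : nrm (z k - a ⋅ z k) = nrm (z k - z k ⋅ a).
    by rewrite -nrm_star !sexpand zs as_.
  rewrite nrmBC.
  have -> : z k - a ⋅ z k ⋅ a = (z k - a ⋅ z k) + a ⋅ (z k - z k ⋅ a).
    by rewrite !cexpand; abel.
  have := nrmD (z k - a ⋅ z k) (a ⋅ (z k - z k ⋅ a)).
  have := nrmM_le a1 (lexx (nrm (z k - z k ⋅ a))); lra.
have [zs z1 _] := zP k; have := IHd k.+1; rewrite iterS addSnnS => h.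
have /andP[i0 _] := iterP k _ (s0 (k + d.+1)%N).
have [ts t1 _] := towerP d.+1 k.+1; have [ts' t1' _] := towerP d k.+1.
by have [_ /(_ (z k) _ _ z1 ts t1 ts' t1' h)] := kP _ i0.
Qed.

End Tower.

Lemma refine_absorbing_sequence (b z : nat -> A) :
    (forall n, b n ⋅ b n.+1 = b n) ->
    (forall n, [/\ cstar (z n) = z n, nrm (z n) <= 1 & b n ⋅ z n = b n]) ->
    (forall d k, nrm (tower z d.+1 k - tower z d k) <=
      rate (k + d) - rate (k + d).+1) ->
  exists w : nat -> A, forall n, [/\ cstar (w n) = w n, nrm (w n) <= 1,
    b n ⋅ w n = b n, w n ⋅ ramp true (w n.+1) = w n & nrm (z n - w n) <= rate n].
Proof.
move=> bS zP tS.
have lim k : exists l, forall d, nrm (tower z d k - l) <= rate (k + d).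
  apply: telescope_lim => d; first by rewrite ltW ?rate_gt0 // rate_le ?leq_addl.
  by rewrite addnS; exact: tS.
have [w wP] := choice lim; exists w.
have wR d k : nrm (tower z d k - w k) <= rate d.
  by apply: le_trans (wP k d) _; rewrite rate_le ?leq_addl.
have ws n : cstar (w n) = w n.
  apply/eqP; rewrite -subr_eq0; apply/eqP/nrm_eq0.
  apply: (rate_small (K := 2)) => d; have [ts _ _] := towerP bS zP d n.
  have h := wR d n.
  have := nrmB (tower z d n - w n) (cstar (tower z d n - w n)).
  rewrite nrm_star !sexpand ts.
  have -> (x y y' : A) : x - y - (x + - y') = y' - y by abel.
  lra.
have w1 n : nrm (w n) <= 1.
  rewrite -subr_le0; apply: (rate_small (K := 1)) => d.
  have [_ t1 _] := towerP bS zP d n; have h := wR d n.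
  have := nrmB (tower z d n) (tower z d n - w n).
  by rewrite opprB addrCA subrr addr0; lra.
move=> n; split=> //.
- apply/esym/eqP; rewrite -subr_eq0; apply/eqP/nrm_eq0.
  apply: (rate_small (K := nrm (b n))) => d; have [_ _ bt] := towerP bS zP d n.
  rewrite -{1}bt -cmulNr -cmulDr; exact: nrmM_le (wR d n).
- apply/esym/eqP; rewrite -subr_eq0; apply/eqP/nrm_eq0/ler_addgt0Pl => e e0.
  have [|d d0 dP] := ramp_cont (e := e / 3); first by lra.
  have [N NP] : exists N, rate N <= Num.min d (e / 3).
    by apply: rate_lt; rewrite lt_min d0; lra.
  move: NP; rewrite le_min => /andP[Nd Ne].
  have [ts t1 _] := towerP bS zP N n.+1.
  have h := dP true _ _ ts t1 (ws n.+1) (w1 n.+1) (le_trans (wR N n.+1) Nd).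
  have hT := le_trans (le_trans (wR N.+1 n) (rate_le (leqnSn N))) Ne.
  have [_ T1 _] := towerP bS zP N.+1 n; have TQ := tower_absorbed bS zP N n.
  have q1 := ramp_le1 (ws n.+1) (w1 n.+1) true.
  move: (tower z N.+1 n) (ramp true (tower _ _ _)) (ramp true (w _)) T1 hT
    TQ h q1.
  move=> T Q q T1 hT TQ h q1.
  have -> : w n - w n ⋅ q = (T - w n) ⋅ q + T ⋅ (Q - q) - (T - w n).
    by rewrite !cexpand TQ; abel.
  have := nrmB ((T - w n) ⋅ q + T ⋅ (Q - q)) (T - w n).
  have := nrmD ((T - w n) ⋅ q) (T ⋅ (Q - q)).
  have := nrmM_le hT q1; have := nrmM_le T1 h; lra.
- by have := wP n 0%N; rewrite addn0.
Qed.
Lemma absorbing_sequence (e b : nat -> A) :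
    (forall n, cstar (e n) = e n /\ nrm (e n) <= 1) ->
    (forall Y : set A, finite_set Y -> forall d : R, 0 < d ->
      exists n, forall y, Y y -> nrm (y - y ⋅ e n) <= d) ->
    (forall n, cstar (b n) = b n /\ nrm (b n) <= 1) ->
    (forall n, b n ⋅ b n.+1 = b n) ->
  exists h : nat -> A, forall n, [/\ cstar (h n) = h n, nrm (h n) <= 1,
    b n ⋅ h n = b n, h n ⋅ h n.+1 = h n &
    forall i, (i <= n)%N -> nrm (e i - e i ⋅ h n) <= 48 * rate n].
Proof.
move=> e1 eX b1 bS.
have [kappa kP] : exists kappa : R -> R, forall eps, 0 < eps ->
    0 < kappa eps <= eps /\
    forall x v u, nrm x <= 1 -> cstar v = v -> nrm v <= 1 ->
      cstar u = u -> nrm u <= 1 -> nrm (v - u) <= kappa eps ->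
      nrm (ramp false v ⋅ x ⋅ ramp false v -
           ramp false u ⋅ x ⋅ ramp false u) <= eps.
  have H (eps : R) : exists d : R, 0 < eps -> 0 < d <= eps /\
      forall x v u, nrm x <= 1 -> cstar v = v -> nrm v <= 1 ->
      cstar u = u -> nrm u <= 1 -> nrm (v - u) <= d ->
      nrm (ramp false v ⋅ x ⋅ ramp false v -
           ramp false u ⋅ x ⋅ ramp false u) <= eps.
    have [eps0|_] := ltP 0 eps; last by exists 0.
    by have [d d0 dP] := ramp_low_cont eps0; exists d.
  by have [kappa kP] := choice H; exists kappa.
pose s n := rate n - rate n.+1.
have s0 n : 0 < s n by rewrite subr_gt0 rate_ltS.
have i0 n m : 0 < iter n kappa (s m).
  by elim: n => //= n IHn; have [/andP[]] := kP _ IHn.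
pose tau n := Num.min (rate n) (iter n.-1 kappa (s n.-1) / 48).
have tau0 n : 0 < tau n by rewrite lt_min rate_gt0 divr_gt0.
have step (nx : nat * A) : exists v, [/\ cstar v = v, nrm v <= 1,
    b nx.1 ⋅ v = b nx.1 & forall x, ([set nx.2] `|` e @` `I_nx.1.+1) x ->
      nrm (x - x ⋅ v) <= tau nx.1].
  have [bs1 b1'] := b1 nx.1.+1.
  apply: (absorbing_step e1 eX bs1 b1' (bS _) _ (tau0 _)).
  by rewrite finite_setU; split; [exact: finite_set1|exact: finite_image].
have [f fP] := choice step.
pose z := fix z n := if n is m.+1 then f (n, z m) else f (0%N, 0).
have zE n : exists x, z n = f (n, x) by case: n => [|n]; eexists.
have zP n : [/\ cstar (z n) = z n, nrm (z n) <= 1 & b n ⋅ z n = b n].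
  by have [x ->] := zE n; have [] := fP (n, x).
have zS n : nrm (z n - z n ⋅ z n.+1) <= iter n kappa (s n) / 48.
  have [_ _ _ /(_ (z n) (or_introl erefl))] := fP (n.+1, z n).
  by rewrite le_min => /andP[].
have ze n i : (i <= n)%N -> nrm (e i - e i ⋅ z n) <= rate n.
  move=> ni; have [x ->] := zE n.
  have [_ _ _ /(_ (e i))] := fP (n, x).
  have In : `I_n.+1 i by [].
  move=> /(_ (or_intror (ex_intro2 _ _ i In erefl))).
  by rewrite le_min => /andP[].
have tS := tower_dist bS zP s0 kP zS.
have [w wP] := refine_absorbing_sequence bS zP tS.
exists (fun n => ramp true (w n)) => n; have [ws w1 bw wS zw] := wP n.
split; [exact: ramp_star|exact: ramp_le1|exact: ramp_right_id|exact: ramp_left|].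
move=> i ni; have := ramp_right ws w1 true (e i).
suff : nrm (e i - e i ⋅ w n) <= 2 * rate n by lra.
have -> : e i - e i ⋅ w n = (e i - e i ⋅ z n) + e i ⋅ (z n - w n).
  by rewrite !cexpand; abel.
have [_ ei1] := e1 i; have := nrmD (e i - e i ⋅ z n) (e i ⋅ (z n - w n)).
have := ze _ _ ni; have := nrmM_le ei1 zw; lra.
Qed.

Lemma pos_unit_ball_star a : pos_unit_ball a -> cstar a = a /\ nrm a <= 1.
Proof.
by move=> [[x ->] x1]; rewrite cstarM cstarK -lecR -nrmE.
Qed.

Lemma pos_unit_ball_square h : cstar h = h -> nrm h <= 1 ->
  pos_unit_ball (h ⋅ h).
Proof.
move=> hs h1; split; first by exists h; rewrite hs.
by rewrite nrmE -[1]/(1%:C%C) lecR; have := nrmM_le h1 h1; lra.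
Qed.

Lemma sigma_unital_sequence : sigma_unital A -> exists e : nat -> A,
  (forall n, cstar (e n) = e n /\ nrm (e n) <= 1) /\
  forall Y : set A, finite_set Y -> forall d : R, 0 < d ->
    exists n, forall y, Y y -> nrm (y - y ⋅ e n) <= d.
Proof.
move=> [L [le [u [Lc [[L0 lexx_ letr dir] u1 uA]]]]].
have [|f [_ fs]] := countable_enum Lc; first by have [l _] := L0; exists l.
exists (u \o f); split=> [n|Y Yfin d d0]; first exact/pos_unit_ball_star/u1.
suff [l lP] : exists l, forall l', le l l' -> forall y, Y y ->
    nrm (y - y ⋅ u l') <= d.
  by have [n nl] := fs l I; exists n => y Yy; rewrite /= nl; exact: lP.
have uN y : exists l, forall l', le l l' -> nrm (y - y ⋅ u l') <= d.
  have [|l lP] := uA y d%:C%C; first by rewrite -[0]/(0%:C%C) ltcR.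
  by exists l => l' /lP; rewrite nrmE ltcR => /ltW.
move/finite_seqP: Yfin => [s ->].
elim: s => [|y s [l lP]].
  by have [l _] := L0; exists l => l' _ y; rewrite /= in_nil.
have [l2 l2P] := uN y; have [l3 l13 l23] := dir l l2; exists l3 => l' l3l' x /=.
rewrite in_cons => /predU1P[->|xs]; first by apply: l2P; exact: letr l3l'.
by apply: (lP l') => //; exact: letr l3l'.
Qed.

Lemma ll_trans a b c : ll a b -> ll b c -> ll a c.
Proof. by move=> ab bc; rewrite /ll {1}ab {1}bc cmulA -ab. Qed.

Lemma ll_cofinal_sequence (B : set A) : countable B -> B `<=` pos_unit_ball ->
  ll_directed B -> exists b : nat -> A,
  [/\ forall n, cstar (b n) = b n /\ nrm (b n) <= 1,
    forall n, b n ⋅ b n.+1 = b n & forall x, B x -> exists n, ll x (b n)].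
Proof.
move=> Bc B1 Bd; have [->|B0] := eqVneq B set0.
  exists (fun=> 0); split=> [n|n|//]; last by rewrite cmul0l.
  by rewrite cstar0 nrm0 ler01.
have [f [fB fs]] := countable_enum Bc (proj1 (set0P _) B0).
have H (nx : nat * A) : exists y, B nx.2 -> [/\ B y, ll nx.2 y & ll (f nx.1) y].
  have [Bx|nBx] := pselect (B nx.2); last by exists 0.
  by have [y By [xy fy]] := Bd _ _ Bx (fB nx.1); exists y.
have [g gP] := choice H.
pose b := fix b n := if n is m.+1 then g (m, b m) else f 0%N.
have bB n : B (b n) by elim: n => [|n IHn] //=; have [] := gP (n, b n) IHn.
exists b; split=> [n|n|x /fs[n <-]]; first exact/pos_unit_ball_star/B1.
  by have [_ /esym] := gP (n, b n) (bB n).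
by exists n.+1; have [] := gP (n, b n) (bB n).
Qed.

Lemma nrm_square_absorb a x h : nrm h <= 1 ->
  nrm (a - a ⋅ (h ⋅ h)) <= 4 * nrm (a - a ⋅ x) + 2 * (nrm a * nrm (x - x ⋅ h)).
Proof.
move=> h1.
have H : nrm (a - a ⋅ h) <= 2 * nrm (a - a ⋅ x) + nrm a * nrm (x - x ⋅ h).
  have -> : a - a ⋅ h = (a - a ⋅ x) + a ⋅ (x - x ⋅ h) - (a - a ⋅ x) ⋅ h.
    by rewrite !cexpand; abel.
  have := nrmB ((a - a ⋅ x) + a ⋅ (x - x ⋅ h)) ((a - a ⋅ x) ⋅ h).
  have := nrmD (a - a ⋅ x) (a ⋅ (x - x ⋅ h)); have := nrmM a (x - x ⋅ h).
  have := nrmM_le (lexx (nrm (a - a ⋅ x))) h1; lra.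
have -> : a - a ⋅ (h ⋅ h) = (a - a ⋅ h) + (a - a ⋅ h) ⋅ h.
  by rewrite !cexpand; abel.
have := nrmD (a - a ⋅ h) ((a - a ⋅ h) ⋅ h).
have := nrmM_le (lexx (nrm (a - a ⋅ h))) h1; lra.
Qed.

End CStarAlgebra.

Theorem corollary4p3 (R : realType) (A : cstarAlgType R)
    (hA : sigma_unital A) (B : set A) (cB : countable B)
    (B1 : B `<=` pos_unit_ball) (dB : ll_directed B) :
  exists U : set A, [/\ countable U, ll_unit U & B `<=` U].
Proof.
have [e [e1 eX]] := sigma_unital_sequence hA.
have [b [b1 bS bB]] := ll_cofinal_sequence cB B1 dB.
have [h hP] := absorbing_sequence e1 eX b1 bS.
pose u n := cmul (h n) (h n); pose U := B `|` range u.
have uS n : ll (u n) (u n.+1).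
  have [_ _ _ hS _] := hP n.
  by rewrite /ll /u cmulA -(cmulA _ (h n)) hS -cmulA hS.
have u_le m n : (m < n)%N -> ll (u m) (u n).
  elim: n => // n IHn; rewrite ltnS leq_eqVlt => /predU1P[->//|/IHn mn].
  exact: ll_trans mn (uS n).
have bu n : ll (b n) (u n).
  by have [_ _ bh _ _] := hP n; rewrite /ll /u cmulA !bh.
have ult x : U x -> exists n, forall m, (n < m)%N -> ll x (u m).
  move=> [/bB[n xb]|[n _ <-]]; exists n => m nm; last exact: u_le.
  exact: ll_trans (ll_trans xb (bu n)) (u_le _ _ nm).
exists U; split; last by left.
  have -> : U = \bigcup_(i in [set: bool]) (if i then B else range u).
    apply/seteqP; split=> [x [Bx|ux]|x [[] _]];
      by [exists true|exists false|left|right].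
  apply: bigcup_countable => // -[_ //|_].
  exact: sub_countable (card_image_le u setT) (countableP _).
split.
- move=> x [/B1//|[n _ <-]]; have [hs h1 _ _ _] := hP n.
  exact: pos_unit_ball_square.
- move=> x y /ult[m xm] /ult[n yn]; exists (u (maxn m n).+1).
    by right; exists (maxn m n).+1.
  by split; [apply: xm|apply: yn]; rewrite ltnS ?leq_maxl ?leq_maxr.
- move=> a eps eps0.
  have [d d0 ->] := complex_gt0_real eps0.
  have [|n en] := eX [set a] (finite_set1 a) (d / 16); first by lra.
  have {}en := en a erefl; have a0 := nrm_ge0 a.
  have K0 : 0 < 48 * (nrm a + 1) by lra.
  have [|N NP] := @rate_lt R (d / 16 / (48 * (nrm a + 1))).
    by apply: divr_gt0 => //; lra.
  pose m := maxn n N; have [hs h1 _ _ he] := hP m.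
  exists (u m); first by right; exists m.
  rewrite nrmE ltcR; have {he}hen := he n (leq_maxl _ _).
  have mP : rate R m * (48 * (nrm a + 1)) <= d / 16.
    rewrite -ler_pdivlMr //; exact: le_trans (rate_le R (leq_maxr n N)) NP.
  have r0 := rate_gt0 R m.
  have hena : nrm a * nrm (e n - cmul (e n) (h m)) <= nrm a * (48 * rate R m).
    exact: ler_wpM2l.
  have := nrm_square_absorb a (e n) h1; rewrite -/(u m); lra.
Qed.
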